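(* Let $X$ be a well-filtered topological space, and let $P_S(X)$ be its Smyth power space, i.e. the set $K(X)$ of all nonempty compact saturated subsets of $X$ endowed with the upper Vietoris topology. If $P_S(X)$ is a sequential space, then the upper Vietoris topology on $K(X)$ coincides with the Scott topology $\sigma(K(X))$ of the poset $(K(X),\supseteq)$.
   Context: The specialization order on a space $X$ is $x\le y \iff x\in\overline{\{y\}}$. A subset $A\subseteq X$ is saturated if it is an upper set in the specialization order (equivalently, an intersection of open sets). A nonempty family $\mathcal F$ of sets is filtered if any two members contain a common member of $\mathcal F$. $X$ is well-filtered if for each filtered family $\mathcal F$ of compact saturated subsets of $X$ and each open $U\subseteq X$, $\bigcap\mathcal F\subseteq U$ implies $F\subseteq U$ for some $F\in\mathcal F$. $K(X)$ is the poset of all nonempty compact saturated subsets of $X$, ordered by reverse inclusion ($K\le Q\iff K\supseteq Q$). The upper Vietoris topology on $K(X)$ has as a base the sets $\Box U=\{K\in K(X)\mid K\subseteq U\}$, $U$ open in $X$. A subset $U$ of a poset $P$ is Scott open if it is an upper set and, for each directed (nonempty, any two elements have an upper bound in $D$) subset $D\subseteq P$ whose supremum exists, $\bigvee D\in U$ implies $D\cap U\ne\emptyset$. The Scott open sets form the Scott topology $\sigma(P)$. A subset $A$ of a space $Y$ is sequentially closed if whenever a sequence in $A$ converges to $y\in Y$, then $y\in A$. $Y$ is a sequential space if every sequentially closed subset is closed. *)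

(* Defs.v *)
From HB Require Import structures.
From mathcomp Require Import all_boot all_order.
From mathcomp Require Import all_classical.
From mathcomp Require Import topology.

Set Implicit Arguments.
Unset Strict Implicit.
Unset Printing Implicit Defensive.

Local Open Scope classical_set_scope.
Local Open Scope order_scope.

Definition specialization_le (X : topologicalType) (x y : X) : Prop :=
  closure [set y] x.

Definition saturated (X : topologicalType) (A : set X) : Prop :=
  forall x y : X, specialization_le x y -> A x -> A y.

Definition filtered_family (T : Type) (F : set (set T)) : Prop :=
  F !=set0 /\
  forall A B, F A -> F B -> exists2 C, F C & C `<=` A /\ C `<=` B.

Definition well_filtered (X : topologicalType) : Prop :=
  forall F : set (set X),
    filtered_family F -> (forall K, F K -> compact K /\ saturated K) ->
  forall U : set X, open U ->
    \bigcap_(K in F) K `<=` U -> exists2 K, F K & K `<=` U.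

(* [smyth X] is the set K(X); it carries both the order (reverse inclusion) and
   the upper Vietoris topology, so it also stands for the space P_S(X). *)
Record smyth (X : topologicalType) := Smyth {
  smyth_set :> set X;
  smyth_neq0 : smyth_set !=set0;
  smyth_compact : compact smyth_set;
  smyth_saturated : saturated smyth_set
}.

Lemma smyth_inj (X : topologicalType) (K Q : smyth X) :
  K = Q :> set X -> K = Q.
Proof.
case: K Q => [K K0 cK sK] [Q Q0 cQ sQ] /= eKQ; case: _ / eKQ Q0 cQ sQ => *.
by congr Smyth; exact: Prop_irrelevance.
Qed.

HB.instance Definition _ (X : topologicalType) := gen_eqMixin (smyth X).
HB.instance Definition _ (X : topologicalType) := gen_choiceMixin (smyth X).

Section smyth_order.
Context {X : topologicalType}.

Definition smyth_le (K Q : smyth X) : bool :=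
  `[< (Q : set X) `<=` (K : set X) >].

Lemma smyth_le_refl : reflexive smyth_le.
Proof. by move=> K; apply/asboolP. Qed.

Lemma smyth_le_anti : antisymmetric smyth_le.
Proof.
by move=> K Q /andP[/asboolP QK /asboolP KQ]; exact/smyth_inj/seteqP.
Qed.

Lemma smyth_le_trans : transitive smyth_le.
Proof.
by move=> Q K P /asboolP QK /asboolP PQ; apply/asboolP => x /PQ /QK.
Qed.

End smyth_order.

HB.instance Definition _ (X : topologicalType) :=
  Order.Le_isPOrder.Build Order.default_display (smyth X)
    (@smyth_le_refl X) (@smyth_le_anti X) (@smyth_le_trans X).

Section upper_vietoris.
Context {X : topologicalType}.

Definition smyth_box (U : set X) : set (smyth X) :=
  [set K | (K : set X) `<=` U].

Lemma smyth_box_cover :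
  \bigcup_(U in [set U : set X | open U]) smyth_box U = setT.
Proof. by apply/seteqP; split=> // K _; exists setT => //; exact: openT. Qed.

Lemma smyth_box_join (U V : set X) (K : smyth X) : open U -> open V ->
  smyth_box U K -> smyth_box V K ->
  exists W, [/\ open W, smyth_box W K &
    smyth_box W `<=` smyth_box U `&` smyth_box V].
Proof.
move=> oU oV KU KV; exists (U `&` V); split; first exact: openI.
- by move=> x Kx; split; [exact: KU|exact: KV].
- by move=> Q QUV; split=> x /QUV[].
Qed.

End upper_vietoris.

HB.instance Definition _ (X : topologicalType) :=
  isBaseTopological.Build (smyth X)
    (@smyth_box_cover X) (@smyth_box_join X).

Definition directed_set (d : Order.disp_t) (P : porderType d) (D : set P) :
    Prop :=
  D !=set0 /\
  forall x y, D x -> D y -> exists2 z, D z & x <= z /\ y <= z.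

Definition scott_open (d : Order.disp_t) (P : porderType d) (U : set P) :
    Prop :=
  (forall x y, x <= y -> U x -> U y) /\
  (forall (D : set P) (s : P),
    directed_set D -> supremums D s -> U s -> D `&` U !=set0).

Definition scott_topology (d : Order.disp_t) (P : porderType d) :
  set (set P) := [set U | scott_open U].
Arguments scott_topology {d} P.

Definition sequentially_closed (Y : topologicalType) (A : set Y) : Prop :=
  forall (u : nat -> Y) (y : Y),
    (forall n, A (u n)) -> u @ \oo --> y -> A y.

Definition sequential_space (Y : topologicalType) : Prop :=
  forall A : set Y, sequentially_closed A -> closed A.

(* Main.v *)
Require Import Defs.
From mathcomp Require Import all_boot all_order.
From mathcomp Require Import all_classical.
From mathcomp Require Import topology.

(** In a well-filtered space the intersection of a filtered family of nonempty
    compact saturated sets is again one, hence is the supremum in [K(X)], and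
    well-filteredness makes the boxes Scott open.  Conversely, if [u n]
    converges to [K] in the Smyth power space, the sets
    [Q n = K `|` \bigcup_(m >= n) u m] are compact saturated and decrease to
    [K]; a Scott open set containing [K] thus contains some [Q n], hence
    [u n].  So the complement of a Scott open set is sequentially closed. *)

Set Implicit Arguments.
Unset Strict Implicit.
Unset Printing Implicit Defensive.

Local Open Scope classical_set_scope.

Lemma smyth_leP {X : topologicalType} (K Q : smyth X) :
  reflect ((Q : set X) `<=` (K : set X)) (K <= Q)%O.
Proof. exact: asboolP. Qed.

Lemma open_smythP {X : topologicalType} (A : set (smyth X)) :
  open A <-> forall K, A K ->
    exists U : set X, [/\ open U, smyth_box U K & smyth_box U `<=` A].
Proof.
split=> [[D oD <-] K [U DU UK]|H].
  by exists U; split; [exact: oD|exact: UK|move=> Q UQ; exists U].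
exists [set U | open U /\ smyth_box U `<=` A]; first by move=> U [].
apply/seteqP; split=> [K [U [_ UA] UK]|K /H[U [oU UK UA]]]; first exact: UA.
by exists U.
Qed.

Lemma open_smyth_box {X : topologicalType} (U : set X) :
  open U -> open (smyth_box U).
Proof. by move=> oU; apply/open_smythP => K UK; exists U; split. Qed.

(** If a filter [G] on the intersection had no cluster point there, the open sets missing some
    member of [G] would cover it. By well-filteredness they cover some [K] in [F], yet [G] clusters
    in the compact set [K]. *)
Lemma well_filtered_bigcap_compact {X : topologicalType} (F : set (set X)) :
  well_filtered X -> filtered_family F ->
  (forall K, F K -> compact K /\ saturated K) ->
  compact (\bigcap_(K in F) K).
Proof.
move=> wfX fF cF G PG GI; apply: contrapT => noclus.
pose U := \bigcup_(B in [set B | open B /\ exists2 A, G A & A `&` B = set0]) B.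
have oU : open U by apply: bigcup_open => B [].
have IU : \bigcap_(K in F) K `<=` U.
  move=> x Ix; have : ~ cluster G x by move=> cx; apply: noclus; exists x.
  rewrite clusterEonbhs => /existsNP[A /existsNP[B /not_implyP[GA]]].
  move=> /not_implyP[[oB Bx] /set0P/negP/negPn/eqP AB].
  by exists B => //; split=> //; exists A.
have [K FK KU] := wfX F fF cF U oU IU.
have GK : G K by apply: filterS GI => x; exact.
have [x [/KU[B [oB [A GA AB]] Bx]]] := (cF K FK).1 G PG GK.
rewrite clusterEonbhs => /(_ A B GA (conj oB Bx)).
by rewrite AB => -[].
Qed.

Lemma open_smyth_scott {X : topologicalType} (A : set (smyth X)) :
  well_filtered X -> open A -> scott_open A.
Proof.
move=> wfX /open_smythP oA; split.
  move=> K Q /smyth_leP QK /oA[U [_ KU]]; apply.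
  exact: subset_trans QK KU.
move=> D s [[K0 DK0] dirD] [_ sleast] /oA[V [oV sV VA]].
pose F := [set K : set X | exists2 Q : smyth X, D Q & (Q : set X) = K].
have fF : filtered_family F.
  split; first by exists K0, K0.
  move=> _ _ [K DK <-] [Q DQ <-].
  have [M DM [/smyth_leP MK /smyth_leP MQ]] := dirD _ _ DK DQ.
  by exists M => //; exists M.
have cF K : F K -> compact K /\ saturated K.
  by move=> [Q _ <-]; split; [exact: smyth_compact|exact: smyth_saturated].
(* Well-filteredness at the empty open set: an empty intersection would force an empty member. *)
have I0 : \bigcap_(K in F) K !=set0.
  apply/set0P/negP => /eqP I0.
  have [||_ [Q _ <-] Q0] := wfX F fF cF set0; first exact: open0.
    by rewrite I0.
  by have [x /Q0] := smyth_neq0 Q.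
have sI : saturated (\bigcap_(K in F) K).
  by move=> x y xy Ix K FK; exact: (cF K FK).2 xy (Ix K FK).
pose I := Smyth I0 (well_filtered_bigcap_compact wfX fF cF) sI.
(* [I] is an upper bound of [D], so the intersection lies inside [s], hence inside [V]. *)
have /smyth_leP Is : (s <= I)%O.
  by apply: sleast => K DK; apply/smyth_leP => x; apply; exists K.
have [|_ [K DK <-] KV] := wfX F fF cF V oV; first exact: subset_trans Is sV.
by exists K; split=> //; exact: VA.
Qed.

(** A point of [K] in the closure of [x] would put [x] into [K] by saturation. *)
Lemma saturated_open_sep {X : topologicalType} (K : set X) (x : X) :
  saturated K -> ~ K x -> exists U, [/\ open U, K `<=` U & ~ U x].
Proof.
move=> sK nKx; exists (~` closure [set x]); split.
- exact/closed_openC/closed_closure.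
- by move=> k Kk kx; exact/nKx/(sK k).
- by apply; exact: subset_closure.
Qed.

Lemma compact_noncluster_sep {X : topologicalType} (K : set X)
    (F : set_system X) : compact K -> ProperFilter F ->
  K `&` cluster F = set0 ->
  exists2 A, F A & exists U, [/\ open U, K `<=` U & A `&` U = set0].
Proof.
move=> /compact_near_coveringP cK PF KF0.
(* [P] is antitone in [A], so a property near the small members of [F] comes down to a single
   member; near-covering compactness makes that member uniform over [K]. *)
pose P (A : set X) (y : X) := interior (~` A) y.
have /near_powerset_filter_fromP[] :
    \forall A \near powerset_filter_from F, K `<=` P A.
- apply: cK => x Kx.
  have : ~ cluster F x by move=> cx; rewrite -[False]/(set0 x) -KF0.
  rewrite clusterEonbhs => /existsNP[A /existsNP[B /not_implyP[FA]]].
  move=> /not_implyP[[oB Bx] /set0P/negP/negPn/eqP AB].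
  exists (B, [set A' | A' `<=` A]) => /=.
    by split; [exact: open_nbhs_nbhs|exact: small_set_sub].
  move=> [y A'] [/= By A'A].
  rewrite /P /interior nbhsE; exists B => // z Bz A'z.
  by rewrite -[False]/(set0 z) -AB; split=> //; exact: A'A.
- move=> A B AB KB x /KB; apply: interiorS; exact: subsetC.
- move=> A FA KA; exists A => //; exists (interior (~` A)); split=> //.
    exact: open_interior.
  by rewrite -subset0 => x [Ax /interior_subset].
Qed.

Section tails.
Context {X : topologicalType} (u : nat -> smyth X) (K : smyth X).

(** The limit [K] is included because the union of the tail alone need not be compact. *)
Definition tail_hull (n : nat) : set X :=
  (K : set X) `|` \bigcup_(m in [set m | n <= m]%N) (u m : set X).

Lemma tail_hull_neq0 n : tail_hull n !=set0.
Proof. by have [x Kx] := smyth_neq0 K; exists x; left. Qed.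

Lemma tail_hull_saturated n : saturated (tail_hull n).
Proof.
move=> x y xy [Kx|[m nm mx]]; first by left; exact: smyth_saturated xy Kx.
by right; exists m => //; exact: smyth_saturated xy mx.
Qed.

Hypothesis uK : u @ \oo --> K.

Lemma cvg_smyth_box (U : set X) : open U -> (K : set X) `<=` U ->
  exists N, forall m, (N <= m)%N -> (u m : set X) `<=` U.
Proof.
move=> oU KU; have /uK[N _ uN] : nbhs K (smyth_box U).
  by apply: open_nbhs_nbhs; split => //; exact: open_smyth_box.
by exists N => m; exact: uN.
Qed.

Lemma tail_hull_compact n : compact (tail_hull n).
Proof.
move=> F PF FQ; have [KF0|/set0P[x [Kx cx]]] := eqVneq (K `&` cluster F) set0;
  last by exists x; split=> //; left.
have [A FA [U [oU KU AU]]] := 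
  compact_noncluster_sep (@smyth_compact _ K) PF KF0.
have [N uN] := cvg_smyth_box oU KU.
(* Only these finitely many terms can leave [U], so [A], which misses [U], meets the hull inside the
   compact set [C]. *)
pose C := \big[setU/set0]_(n <= m < N) (u m : set X).
have CE : C `<=` \bigcup_(m in [set m | n <= m]%N) (u m : set X).
  rewrite /C -bigcup_seq => x [m /=]; rewrite mem_index_iota => /andP[nm _] mx.
  by exists m.
have cC : compact C by apply: bigsetU_compact => m _; exact: smyth_compact.
have FC : F C.
  apply: filterS (filterI FA FQ) => x [Ax Qx].
  have nUx : ~ U x by move=> Ux; rewrite -[False]/(set0 x) -AU.
  case: Qx => [/KU//|[m nm mx]].
  have [/uN/(_ _ mx)//|mN] := leqP N m.
  by rewrite /C -bigcup_seq; exists m => //=; rewrite mem_index_iota nm.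
have [x [Cx cx]] := cC F PF FC.
by exists x; split=> //; right; exact: CE.
Qed.

Definition smyth_tail (n : nat) : smyth X :=
  Smyth (tail_hull_neq0 n) (@tail_hull_compact n) (@tail_hull_saturated n).

Lemma le_smyth_tail m n : (m <= n)%N -> (smyth_tail m <= smyth_tail n)%O.
Proof.
move=> mn; apply/smyth_leP => x [Kx|[k nk kx]]; first by left.
by right; exists k => //=; exact: leq_trans nk.
Qed.

Lemma directed_smyth_tail : directed_set (range smyth_tail).
Proof.
split; first by exists (smyth_tail 0), 0%N.
move=> _ _ [m _ <-] [n _ <-]; exists (smyth_tail (maxn m n)).
  by exists (maxn m n).
by split; apply: le_smyth_tail; rewrite ?leq_maxl ?leq_maxr.
Qed.

Lemma supremums_smyth_tail : supremums (range smyth_tail) K.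
Proof.
split=> [_ [n _ <-]|L ubL]; first by apply/smyth_leP => x; left.
apply/smyth_leP => x Lx; apply: contrapT => nKx.
(* An open [U] around [K] missing [x] contains a whole [tail_hull], and [L] lies inside that
   hull. *)
have [U [oU KU nUx]] := saturated_open_sep (@smyth_saturated _ K) nKx.
have [N uN] := cvg_smyth_box oU KU; apply: nUx.
have /smyth_leP/(_ x Lx)[/KU//|[m Nm mx]] : (smyth_tail N <= L)%O.
  by apply: ubL; exists N.
exact: uN Nm _ mx.
Qed.

(** [A] contains the supremum [K] of the hulls, hence some hull; [u n] is a subset of it, so it lies
    above it in the reverse inclusion order. *)
Lemma scott_open_cvg (A : set (smyth X)) :
  scott_open A -> A K -> exists n, A (u n).
Proof.
move=> [upA scA] AK.
have [_ [[n _ <-] An]] :=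
  scA _ _ directed_smyth_tail supremums_smyth_tail AK.
by exists n; apply: upA An; apply/smyth_leP => x nx; right; exists n => /=.
Qed.

End tails.

Theorem theorem3p10 (X : topologicalType) (wfX : well_filtered X)
    (seqX : sequential_space (smyth X)) :
  [set U : set (smyth X) | open U]%classic = scott_topology (smyth X).
Proof.
apply/seteqP; split=> A; first exact: open_smyth_scott.
move=> scA; rewrite /= -[A]setCK; apply: closed_openC; apply: seqX.
move=> u K nAu uK AK.
by have [n] := scott_open_cvg uK scA AK; exact: nAu.
Qed.
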